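(* Let $\lambda\in\mathbb{R}$ and $r\in\mathbb{N}\cup\{0\}$. For all integers $n,k\ge0$, $$\frac{1}{k!}\sum_{m=0}^{n}\lambda^{n-m}S_1(n,m)\,\Delta^k r^m=\begin{cases}0&\text{if } n<k,\\ S_{2,r}(n+r,k+r|\lambda)&\text{if } n\ge k.\end{cases}$$
   Context: All generating functions are formal power series in $t$. For a number $y$, $(1+\lambda t)^{y/\lambda}$ denotes the formal power series $\sum_{n\ge0}(y|\lambda)_n\frac{t^n}{n!}$, where $(y|\lambda)_0=1$ and $(y|\lambda)_n=y(y-\lambda)(y-2\lambda)\cdots(y-(n-1)\lambda)$ for $n\ge1$ (for $\lambda=0$ this is the limit $e^{yt}$). The convention $0^0=1$ is used. $\Delta$ is the forward difference operator $\Delta f(x)=f(x+1)-f(x)$, and $\Delta^k r^m$ denotes $\Delta^k$ applied to the function $f(x)=x^m$ and evaluated at $x=r$, i.e. $\Delta^k r^m=\sum_{l=0}^k\binom{k}{l}(-1)^{k-l}(l+r)^m$. The (signed) Stirling numbers of the first kind $S_1(n,k)$ are defined by $(x)_n=\sum_{k=0}^n S_1(n,k)x^k$, where $(x)_0=1$ and $(x)_n=x(x-1)\cdots(x-n+1)$ for $n\ge1$. The extended degenerate Stirling numbers of the second kind $S_{2,r}(n+r,k+r|\lambda)$ are defined, for $r,k\in\mathbb{N}\cup\{0\}$, by $$\frac{1}{k!}(1+\lambda t)^{r/\lambda}\left((1+\lambda t)^{1/\lambda}-1\right)^k=\sum_{n=k}^\infty S_{2,r}(n+r,k+r|\lambda)\frac{t^n}{n!}.$$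 *)

(* Defs.v *)
From mathcomp Require Import all_boot all_order all_algebra.
From mathcomp Require Import reals.
Set Implicit Arguments.
Unset Strict Implicit.
Unset Printing Implicit Defensive.
Import Order.TTheory GRing.Theory Num.Theory.
Local Open Scope ring_scope.

Definition fdiff (R : nzRingType) (f : R -> R) (x : R) : R := f (x + 1) - f x.

Definition falling_poly (n : nat) : {poly int} := \prod_(i < n) ('X - i%:R%:P).

Definition stirling1 (n k : nat) : int := (falling_poly n)`_k.

Lemma stirling1E (R : comNzRingType) (x : R) (n : nat) :
  \prod_(i < n) (x - i%:R) = \sum_(k < n.+1) (stirling1 n k)%:~R * x ^+ k.
Proof.
have size_le : (size (falling_poly n) <= n.+1)%N.
  by rewrite /falling_poly size_prod_XsubC /index_enum -enumT size_enum_ord.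
transitivity (map_poly intr (falling_poly n)).[x].
  rewrite rmorph_prod horner_prod; apply: eq_bigr => i _.
  by rewrite rmorphB /= map_polyX map_polyC /= hornerXsubC rmorph_nat.
rewrite (@horner_coef_wide _ n.+1); last exact: leq_trans (size_poly _ _) _.
by apply: eq_bigr => i _; rewrite coef_map.
Qed.

(* A formal power series in t is its coefficient sequence:
   [a : fps R] stands for \sum_n a n t^n. *)
Definition fps (R : Type) := nat -> R.

Section Fps.
Variable R : nzRingType.
Implicit Types a b : fps R.

Definition fps_one : fps R := fun n => (n == 0%N)%:R.
Definition fps_sub a b : fps R := fun n => a n - b n.
Definition fps_mul a b : fps R := fun n => \sum_(i < n.+1) a i * b (n - i)%N.
Definition fps_scale (c : R) a : fps R := fun n => c * a n.
Definition fps_exp a (k : nat) : fps R := iter k (fps_mul a) fps_one.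

End Fps.

Section DegenerateStirling.
Variables (R : fieldType) (lambda : R).

Definition dfalling (y : R) (n : nat) : R := \prod_(i < n) (y - i%:R * lambda).

(* (1 + lambda t)^(y / lambda); for lambda = 0 this is e^(y t), since then
   (y | 0)_n = y^n. *)
Definition dexp (y : R) : fps R := fun n => dfalling y n / n`!%:R.

Definition dstirling2_gf (r k : nat) : fps R :=
  fps_scale k`!%:R^-1
    (fps_mul (dexp r%:R) (fps_exp (fps_sub (dexp 1) (fps_one R)) k)).

(* [dstirling2 r N K] is S_{2,r}(N, K | lambda), meaningful for r <= K <= N:
   with N = n + r and K = k + r it is n! times the coefficient of t^n in the
   generating function with parameters r and k. *)
Definition dstirling2 (r N K : nat) : R :=
  (N - r)`!%:R * dstirling2_gf r (K - r) (N - r)%N.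

End DegenerateStirling.

Lemma fps_exp_order (R : nzRingType) (a : fps R) (k n : nat) :
  a 0%N = 0 -> (n < k)%N -> fps_exp a k n = 0.
Proof.
move=> a0; elim: k n => [//|k IHk] n lt_nk.
apply: big1 => -[[|i] /= lt_in] _; first by rewrite a0 mul0r.
rewrite [X in _ * X]IHk ?mulr0 // ltn_subLR //.
by rewrite addSn (leq_trans lt_nk) // ltnS leq_addl.
Qed.

(* The generating function is indeed
   \sum_(n >= k) S_{2,r}(n + r, k + r | lambda) t^n / n!. *)
Lemma dstirling2_gfE (R : numFieldType) (lambda : R) (r k n : nat) :
  dstirling2_gf lambda r k n =
  if (k <= n)%N then dstirling2 lambda r (n + r) (k + r) / n`!%:R else 0.
Proof.
case: leqP => [_|lt_nk].
  by rewrite /dstirling2 !addnK mulrC mulKf // pnatr_eq0 -lt0n fact_gt0.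
rewrite /dstirling2_gf /fps_scale /fps_mul big1 ?mulr0 // => i _.
rewrite fps_exp_order ?mulr0 //; last exact: leq_ltn_trans (leq_subr _ _) lt_nk.
by rewrite /fps_sub /fps_one /dexp /dfalling big_ord0 fact0 divr1 subrr.
Qed.

(* Main.v *)
(* The series dexp y satisfy dexp (y + z) = dexp y * dexp z, so multiplying
   dexp y by dexp 1 - 1 is the forward difference in y; hence the coefficients
   of dexp y * (dexp 1 - 1)^k are the k-th differences of the degenerate falling
   factorials (y|lambda)_n / n!.  Expanding (y|lambda)_n in powers of y by
   homogenizing the definition of S_1 gives the left-hand side. *)
Require Import Defs.
From mathcomp Require Import all_boot all_order all_algebra.
From mathcomp Require Import reals.
From mathcomp Require Import ring.
Set Implicit Arguments.
Unset Strict Implicit.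
Unset Printing Implicit Defensive.
Import Order.TTheory GRing.Theory Num.Theory.
Local Open Scope ring_scope.

Section FpsRing.
Variable R : nzRingType.
Implicit Types a b c : fps R.

(** The coefficient at [n] only sees terms of index at most [n], so truncation is harmless and
    associativity of [fps_mul] can be inherited from [{poly R}]. *)
Lemma fps_mul_coef N a b n : (n < N)%N ->
  fps_mul a b n = ((\poly_(i < N) a i) * (\poly_(i < N) b i))`_n.
Proof.
move=> lt_nN; rewrite coefM; apply: eq_bigr => i _.
by rewrite !coef_poly !(leq_ltn_trans _ lt_nN) ?leq_subr // -ltnS.
Qed.

Lemma fps_mulA a b c : fps_mul a (fps_mul b c) =1 fps_mul (fps_mul a b) c.
Proof.
move=> n; transitivity ((\poly_(i < n.+1) a i) *
    ((\poly_(i < n.+1) b i) * (\poly_(i < n.+1) c i)))`_n.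
  rewrite coefM; apply: eq_bigr => i _.
  by rewrite coef_poly ltn_ord -fps_mul_coef // ltnS leq_subr.
rewrite mulrA coefM; apply: eq_bigr => i _.
by rewrite coef_poly ltnS leq_subr -fps_mul_coef.
Qed.

Lemma fps_mul1 a : fps_mul a (fps_one R) =1 a.
Proof.
move=> n; rewrite /fps_mul big_ord_recr /= subnn mulr1 big1 ?add0r // => i _.
by rewrite /fps_one subn_eq0 leqNgt ltn_ord mulr0.
Qed.

Lemma fps_mulBr a b c :
  fps_mul a (fps_sub b c) =1 fps_sub (fps_mul a b) (fps_mul a c).
Proof.
by move=> n; rewrite /fps_sub -sumrB; apply: eq_bigr => i _; rewrite mulrBr.
Qed.

Lemma fps_mulBl a b c :
  fps_mul (fps_sub a b) c =1 fps_sub (fps_mul a c) (fps_mul b c).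
Proof.
by move=> n; rewrite /fps_sub -sumrB; apply: eq_bigr => i _; rewrite mulrBl.
Qed.

Lemma eq_fps_mull a b c : a =1 b -> fps_mul a c =1 fps_mul b c.
Proof. by move=> eq_ab n; apply: eq_bigr => i _; rewrite eq_ab. Qed.

Lemma iter_fdiff_sum (I : Type) (s : seq I) (c : I -> R) (g : I -> R -> R)
    (f : R -> R) k :
  f =1 (fun x => \sum_(i <- s) c i * g i x) ->
  iter k (@fdiff R) f =1 (fun x => \sum_(i <- s) c i * iter k (@fdiff R) (g i) x).
Proof.
move=> eq_f; elim: k => [//|k IHk] x; rewrite iterS {1}/fdiff !IHk -sumrB.
by apply: eq_bigr => i _; rewrite -mulrBr.
Qed.

End FpsRing.

Lemma stirling1nn n : stirling1 n n = 1.
Proof.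
have size_f : size (falling_poly n) = n.+1.
  by rewrite /falling_poly size_prod_XsubC /index_enum -enumT size_enum_ord.
have /monicP : falling_poly n \is monic by exact: monic_prod_XsubC.
by rewrite lead_coefE size_f.
Qed.

Lemma dfalling_stirling1 (R : fieldType) (lambda y : R) n :
  dfalling lambda y n =
  \sum_(0 <= m < n.+1) lambda ^+ (n - m) * (stirling1 n m)%:~R * y ^+ m.
Proof.
rewrite big_mkord /dfalling; have [->|nz_lambda] := eqVneq lambda 0.
  transitivity (y ^+ n).
    rewrite (eq_bigr (fun=> y)) => [|i _]; last by rewrite mulr0 subr0.
    by rewrite prodr_const card_ord.
  (* At [lambda = 0] only the term m = n survives, thanks to 0^0 = 1, and S_1(n, n) = 1. *)
  rewrite big_ord_recr /= subnn expr0 stirling1nn !mul1r big1 ?add0r // => i _.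
  by rewrite expr0n subn_eq0 leqNgt ltn_ord !mul0r.
(* This form lets [stirling1E] be applied at [y / lambda]; the extracted [lambda ^+ n] then absorbs
   the denominators [lambda ^+ m]. *)
transitivity (\prod_(i < n) (lambda * (y / lambda - i%:R))).
  by apply: eq_bigr => i _; rewrite mulrBr mulrCA divff // mulr1 [in RHS]mulrC.
rewrite big_split /= prodr_const card_ord stirling1E mulr_sumr.
apply: eq_bigr => m _; have le_mn : (m <= n)%N by rewrite -ltnS.
rewrite -{1}(subnK le_mn) exprD expr_div_n.
have nz_lm : lambda ^+ m != 0 by rewrite expf_neq0.
by field.
Qed.

Section DegenerateExponential.
Variables (R : numFieldType) (lambda : R).

(** Coefficient form of the differential equation (1 + lambda t) F' = y F satisfied by F = (1 +
    lambda t)^(y / lambda). *)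
Lemma dexpS (y : R) n :
  n.+1%:R * dexp lambda y n.+1 = (y - n%:R * lambda) * dexp lambda y n.
Proof.
rewrite /dexp /dfalling big_ord_recr /= factS natrM.
have nz_n : n.+1%:R != 0 :> R by rewrite pnatr_eq0.
have nz_f : n`!%:R != 0 :> R by rewrite pnatr_eq0 -lt0n fact_gt0.
move: n.+1%:R n`!%:R nz_n nz_f => u v nz_u nz_v.
by field; rewrite nz_u nz_v.
Qed.

(* Both sides satisfy the recurrence dexpS, the left one by the Leibniz rule
   for t d/dt. *)
Lemma dexpD (y z : R) :
  fps_mul (dexp lambda y) (dexp lambda z) =1 dexp lambda (y + z).
Proof.
elim=> [|n IHn].
  by rewrite /fps_mul big_ord1 /dexp /dfalling !big_ord0 fact0 divr1 mulr1.
have nz_n : n.+1%:R != 0 :> R by rewrite pnatr_eq0.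
apply: (mulfI nz_n); rewrite dexpS -IHn /fps_mul !mulr_sumr.
transitivity (
    \sum_(i < n.+2) i%:R * dexp lambda y i * dexp lambda z (n.+1 - i)%N +
    \sum_(i < n.+2)
      dexp lambda y i * ((n.+1 - i)%:R * dexp lambda z (n.+1 - i)%N)).
  rewrite -big_split; apply: eq_bigr => i _ /=.
  have -> : n.+1%:R = i%:R + (n.+1 - i)%:R :> R.
    by rewrite -natrD subnKC // -ltnS.
  by ring.
(* The weight vanishes at i = 0 in the first sum and at i = n + 1 in the second. After a shift in
   the first, both run over i <= n, and [dexpS] yields the factors y - i lambda and z - (n - i)
   lambda, which add up to y + z - n lambda. *)
rewrite big_ord_recl /= !mul0r add0r [X in _ + X]big_ord_recr /= subnn.
rewrite mul0r mulr0 addr0 -big_split; apply: eq_bigr => i _ /=.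
have le_in : (i <= n)%N by rewrite -ltnS.
rewrite /bump /= add1n subSS subSn // !dexpS natrB //.
by ring.
Qed.

Lemma fps_mul_dexp_exp (k n : nat) (y : R) :
  n`!%:R * fps_mul (dexp lambda y)
             (fps_exp (fps_sub (dexp lambda 1) (fps_one R)) k) n =
  iter k (@fdiff R) (dfalling lambda ^~ n) y.
Proof.
elim: k y => [|k IHk] y.
  by rewrite fps_mul1 /dexp mulrC divfK // pnatr_eq0 -lt0n fact_gt0.
rewrite iterS /fdiff -!IHk -mulrBr; congr (_ * _).
(* Associativity moves one factor [dexp 1 - 1] of the power onto [dexp y], turning it into
   [dexp (y + 1) - dexp y]. *)
rewrite [LHS]fps_mulA -[RHS]fps_mulBl; apply: eq_fps_mull => m.
by rewrite fps_mulBr /fps_sub dexpD fps_mul1.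
Qed.

End DegenerateExponential.

Theorem theorem2p4 (R : realType) (lambda : R) (r n k : nat) :
  k`!%:R^-1 *
    \sum_(0 <= m < n.+1)
      lambda ^+ (n - m) * (stirling1 n m)%:~R *
      iter k (@fdiff R) (fun x : R => x ^+ m) r%:R
  = if (n < k)%N then 0 else dstirling2 lambda r (n + r) (k + r).
Proof.
have nz_f : n`!%:R != 0 :> R by rewrite pnatr_eq0 -lt0n fact_gt0.
rewrite -(iter_fdiff_sum k (fun y => dfalling_stirling1 lambda y n)).
rewrite -fps_mul_dexp_exp mulrCA.
(* With n! moved to the front, the rest is by definition the coefficient of t^n in the generating
   function. *)
rewrite -[_^-1 * _]/(dstirling2_gf lambda r k n) dstirling2_gfE.
by case: ltnP => _; rewrite ?mulr0 // mulrC divfK.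
Qed.
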